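(* Let $n\geq 2$ be an integer and let $\{\xi_j\}_{j=0}^{\infty}$ be a non-zero sequence of complex numbers that belongs to $l^p$ for some $p\ge 1$ ($p<\infty$). Suppose that $M_q(\{\xi_j\})=0$ for every integer $q\geq 1$ with $n\nmid q$. Then the non-zero terms of $\{\xi_j\}_{j=0}^{\infty}$ are a rearrangement of a symmetrical sequence of order $n$.
   Context: For a sequence $\{z_j\}_{j=0}^\infty$ of complex numbers and an integer $m\geq1$, the $m$-th moment is $M_m(\{z_j\})=\sum_{j=0}^{\infty} z_j^m$ (the limit of the partial sums in the given order); ''$M_m=0$'' means that this series converges to $0$. Let $\omega_n=e^{2\pi i/n}$. A sequence of complex numbers $\{z_j\}$ is symmetrical of order $n$ if, for all $0\leq k\leq n-1$, $\{z_j\}=\{z_j\omega_n^k\}$ as sets with repetitions (multisets), i.e. each complex number occurs as many times among the $z_j$ as among the $z_j\omega_n^k$. The family of non-zero terms may be finite, in which case the same definition is applied to finite sequences. *)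

(* Defs.v *)
From HB Require Import structures.
From mathcomp Require Import all_boot all_order all_algebra.
From mathcomp Require Import all_classical all_reals all_analysis.
From mathcomp Require Import complex.

Set Implicit Arguments.
Unset Strict Implicit.
Unset Printing Implicit Defensive.

Import Order.TTheory GRing.Theory Num.Theory.
Import numFieldNormedType.Exports.
Import ComplexField.Normc.

Local Open Scope classical_set_scope.
Local Open Scope card_scope.
Local Open Scope ring_scope.

(* The topology of C is the one of its modulus, carried in the library by the
   alias R[i]^o. The series is not required to converge absolutely. *)
Definition moment_is (R : realType) (z : nat -> R[i]) (m : nat) (l : R[i]) : Prop :=
  series (fun j => (z j ^+ m : R[i]^o)) @ \oo --> (l : R[i]^o).

Definition in_lp (R : realType) (p : R) (z : nat -> R[i]) : Prop :=
  (\sum_(0 <= j <oo) (normc (z j) `^ p)%:E < +oo)%E.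

(* e^(2 pi i / n) *)
Definition omega (R : realType) (n : nat) : R[i] :=
  let t : R := 2 * pi / n%:R in Complex (cos t) (sin t).

(* A finite sequence of length N is represented by the restriction to `I_N of
   a function on nat, an infinite one by a function on setT. *)
Definition seq_domain (I : set nat) : Prop :=
  I = setT \/ exists N, I = `I_N.

(* Equality of multisets: every value c has equipotent sets of occurrences. *)
Definition symmetrical (R : realType) (n : nat) (I : set nat)
    (z : nat -> R[i]) : Prop :=
  forall k, (k < n)%N -> forall c : R[i],
    [set j | I j /\ z j = c] #= [set j | I j /\ z j * omega R n ^+ k = c].

Definition rearrangement (T : Type) (A : set nat) (x : nat -> T)
    (I : set nat) (y : nat -> T) : Prop :=
  exists2 f : nat -> nat, set_bij I A f & forall i, I i -> y i = x (f i).

(* Main.v *)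
Require Import Defs.
From HB Require Import structures.
From mathcomp Require Import all_boot all_order all_algebra.
From mathcomp Require Import all_classical all_reals all_analysis.
From mathcomp Require Import complex.
From mathcomp Require Import finmap ring.
Import Order.TTheory GRing.Theory Num.Theory.
Import numFieldNormedType.Exports.
Local Open Scope classical_set_scope.
Local Open Scope ring_scope.

(** Put w = omega^k. Multiplying the sequence by w multiplies its q-th moment
    by w^q; for n %| q this factor is 1, and otherwise the moment is 0. Hence
    the sequences xi and w xi have the same q-th power sums, in the sense that
    the termwise differences xi_j^q - (w xi_j)^q sum to 0, for every q >= 1.
    The theorem follows once such power sums are known to determine the
    multiplicity of each non-zero value ([eq_multiplicity]).

    Analytically this last fact says that the meromorphic function
    \sum_j xi_j^m / (1 - t xi_j) is determined by its Taylor coefficients at 0,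
    while its residues give the multiplicities. The proof below replaces
    the residue computation by polynomial test functions. If u and v have the
    same power sums from the exponent m on, then by linearity
    u_j^m P(u_j) - v_j^m P(v_j) sums to 0 for every polynomial P
    ([series_horner_cvg0]). Fix c <> 0. As the sequences tend to 0, only finitely
    many of their values exceed |c|/2 in modulus; let Q be the product of the
    'X - x over those values x other than c, and take P = 'X^q Q. A term equal
    to c contributes c^(m+q) Q(c), a term equal to another large value
    contributes 0, and the remaining terms are at most |c|^q / 2^q times
    a summable sequence ([sum_isolate_value]). So the two multiplicities of c
    differ by O(2^-q) for all q, and they agree.

    Only large exponents matter, so an exponent m >= p may be chosen, for which
    the m-th powers are absolutely summable ([in_lp_expn_partial_sums]). *)

(** * Roots of unity *)

Lemma expn_cos_sin (R : realType) (t : R) (k : nat) :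
  Complex (cos t) (sin t) ^+ k = Complex (cos (t *+ k)) (sin (t *+ k)).
Proof.
elim: k => [|k IHk]; first by rewrite expr0 mulr0n cos0 sin0.
rewrite exprS IHk mulrS cosD sinD.
by apply/eqP; rewrite eq_complex /= eqxx /= addrC eqxx.
Qed.

Lemma omega_expn (R : realType) (n : nat) :
  (0 < n)%N -> omega R n ^+ n = 1.
Proof.
move=> n_gt0; rewrite /omega expn_cos_sin -(mulr_natr (2 * pi / _)).
by rewrite divfK ?pnatr_eq0 -?lt0n // mulr_natl cos2pi sin2pi.
Qed.

Lemma norm_omega (R : realType) (n : nat) : (0 < n)%N -> `|omega R n| = 1.
Proof.
move=> n_gt0; apply/eqP; rewrite -(pexpr_eq1 n_gt0) //.
by rewrite -normrX omega_expn // normr1.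
Qed.

(** * Summability *)

Lemma norm_normc (R : rcfType) (x : R[i]) :
  `|x| = (ComplexField.Normc.normc x)%:C%C.
Proof. by case: x. Qed.

Lemma normc_ge0 (R : rcfType) (x : R[i]) : 0 <= ComplexField.Normc.normc x.
Proof. by rewrite -ler0c -norm_normc. Qed.

Lemma in_lp_partial_sums (R : realType) (p : R) (z : nat -> R[i]) :
  in_lp p z -> exists K : R, forall N,
    \sum_(0 <= j < N) ComplexField.Normc.normc (z j) `^ p <= K.
Proof.
rewrite /in_lp; set S := (X in (X < _)%E) => S_fin.
have le_S N :
    ((\sum_(0 <= j < N) ComplexField.Normc.normc (z j) `^ p)%:E <= S)%E.
  rewrite -sumEFin; apply: nneseries_lim_ge => j _ _.
  by rewrite lee_fin powR_ge0.
case: S S_fin le_S => [K|//|] _ le_S; last by have := le_S 0%N.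
by exists K => N; rewrite -lee_fin.
Qed.

(** An l^p sequence is bounded, so raising the exponent from p to an integer
    m >= p costs only a bounded factor. Integer exponents are what polynomials
    can act on. *)
Lemma in_lp_expn_partial_sums (R : realType) (p : R) (z : nat -> R[i]) :
  1 <= p -> in_lp p z ->
  exists2 m, (0 < m)%N & exists K : R[i], forall N,
    \sum_(0 <= j < N) `|z j| ^+ m <= K.
Proof.
move=> p_ge1 /in_lp_partial_sums [K leK].
pose a j := ComplexField.Normc.normc (z j).
have a_ge0 j : 0 <= a j by apply: normc_ge0.
have aK j : a j `^ p <= K.
  apply: le_trans (leK j.+1); rewrite big_nat_recr //= lerDr.
  by apply: sumr_ge0 => i _; apply: powR_ge0.
have K_ge0 : 0 <= K by apply: le_trans (aK 0%N); apply: powR_ge0.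
(* Here 1 <= p enters: if a j > 1 then a j <= a j `^ p. *)
have a_le j : a j <= 1 + K.
  have [a_le1|a_gt1] := leP (a j) 1; first by rewrite (le_trans a_le1) ?lerDl.
  apply: le_trans (_ : a j `^ p <= _); last by rewrite (le_trans (aK j)) ?lerDr.
  by rewrite -[leLHS]powRr1 // ler_powR // ltW.
pose m := (Num.truncn p).+1; exists m => //.
have p_lt_m : p < m%:R by apply: truncnS_gt.
have p_le_m : 0 <= m%:R - p by rewrite subr_ge0 ltW.
have am j : a j ^+ m <= a j `^ p * (1 + K) `^ (m%:R - p).
  rewrite -powR_mulrn // -[in leLHS](subrKC p m%:R) powRD; last by rewrite subrKC pnatr_eq0.
  by rewrite ler_wpM2l ?powR_ge0 // ge0_ler_powR // nnegrE ?addr_ge0.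
exists (K * (1 + K) `^ (m%:R - p))%:C%C => N.
rewrite (eq_bigr (fun j => (a j ^+ m)%:C%C)); last first.
  by move=> j _; rewrite rmorphXn /= norm_normc.
rewrite -raddf_sum /= lecR.
apply: le_trans (_ : (\sum_(0 <= j < N) a j `^ p) * (1 + K) `^ (m%:R - p) <= _).
  by rewrite mulr_suml; apply: ler_sum => j _; apply: am.
by rewrite ler_wpM2r ?powR_ge0.
Qed.

(** Bounded partial sums of the m-th powers of the moduli force the terms to
    tend to 0, so that a non-zero value has finitely many terms near or beyond
    its modulus. *)
Lemma partial_sums_small (R : realType) (z : nat -> R[i]) (m : nat) (K eps : R[i]) :
  (forall N, \sum_(0 <= j < N) `|z j| ^+ m <= K) -> 0 < eps ->
  exists J, forall j, (J <= j)%N -> `|z j| < eps.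
Proof.
move=> le_K eps_gt0.
pose a j := ComplexField.Normc.normc (z j).
have a_ge0 j : 0 <= a j by apply: normc_ge0.
have epsE : (complex.Re eps)%:C%C = eps by rewrite RRe_real ?gtr0_real.
have e_gt0 : 0 < complex.Re eps by rewrite -ltcR epsE.
have a_sum : cvgn (series (fun j => a j ^+ m)).
  apply: nondecreasing_is_cvgn.
    by apply: nondecreasing_series => j _ _; apply: exprn_ge0.
  exists (complex.Re K) => _ [N _ <-].
  rewrite -lecR; apply: le_trans (_ : K <= _).
    apply: le_trans (le_K N); rewrite /series /= raddf_sum /=.
    by apply: ler_sum => j _; rewrite rmorphXn /= norm_normc.
  rewrite RRe_real // ger0_real //; apply: le_trans (le_K 0%N).
  by rewrite big_nil.
have /cvgrPdist_lt /(_ (complex.Re eps ^+ m) (exprn_gt0 _ e_gt0)) :=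
  cvg_series_cvg_0 a_sum.
case=> J _ lt_eps; exists J => j /lt_eps /=.
rewrite sub0r normrN ger0_norm ?exprn_ge0 // => am_lt.
rewrite norm_normc -epsE ltcR ltNge; apply/negP => eps_le.
have := lt_le_trans am_lt (lerXn2r m (ltW e_gt0) (a_ge0 j) eps_le).
by rewrite ltxx.
Qed.

(** * Recovering multiplicities from power sums *)

(** The exponent q is quantified after P so that the induction can trade
    a factor 'X of P for an increment of q. *)
Lemma series_horner_cvg0 (R : realType) (u v : nat -> R[i]) (m : nat) :
  (forall q, (m <= q)%N ->
    series (fun j => (u j ^+ q - v j ^+ q : R[i]^o)) @ \oo --> (0 : R[i]^o)) ->
  forall (P : {poly R[i]}) q, (m <= q)%N ->
    series (fun j => (u j ^+ q * P.[u j] - v j ^+ q * P.[v j] : R[i]^o)) @ \oo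
      --> (0 : R[i]^o).
Proof.
move=> cvg0; elim/poly_ind => [|P a IH] q le_mq.
  rewrite (_ : series _ = fun=> 0); first exact: cvg_cst.
  apply/funext => N; rewrite /series /= big1 // => j _.
  by rewrite !horner0 !mulr0 subrr.
rewrite (_ : series _ =
    series (fun j => (u j ^+ q.+1 * P.[u j] - v j ^+ q.+1 * P.[v j] : R[i]^o)) +
    (a \*: series (fun j => (u j ^+ q - v j ^+ q : R[i]^o)) : nat -> R[i]^o)).
  rewrite -[X in _ --> X]addr0; apply: cvgD; first exact: IH (leqW le_mq).
  rewrite -(scaler0 _ a); apply: cvgZl_tmp; exact: cvg0.
apply/funext => N; rewrite fctE /= /series /= scaler_sumr -big_split /=.
apply: eq_bigr => j _; rewrite !hornerMXaddC !exprSr /GRing.scale /=.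
by ring.
Qed.

(** Up to an error of relative size 2^-q, the test polynomial 'X^(m+q) Q sees
    only the value c. The factor `|w| ^+ m is kept in the error term because it
    is what makes the errors summable. *)
Lemma isolate_value (C : numFieldType) (c w B : C) (Q : {poly C}) (m q : nat) :
  c != 0 -> (forall x, `|x| <= `|c| -> `|Q.[x]| <= B) ->
  [\/ w = c, Q.[w] = 0 | `|w| <= `|c| / 2] ->
  `|w ^+ (m + q) * Q.[w] - (w == c)%:R * (c ^+ (m + q) * Q.[c])|
    <= `|w| ^+ m * ((`|c| / 2) ^+ q * B).
Proof.
move=> c_neq0 leB w_cases.
have B_ge0 : 0 <= B by apply: le_trans (leB c (lexx _)).
have rhs_ge0 : 0 <= `|w| ^+ m * ((`|c| / 2) ^+ q * B).
  by rewrite !mulr_ge0 ?exprn_ge0 ?divr_ge0.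
have [w_c|w_neq_c] := eqVneq w c; first by move: rhs_ge0; rewrite w_c mul1r subrr normr0.
rewrite mul0r subr0; case: w_cases => [w_c|->|w_le].
- by rewrite w_c eqxx in w_neq_c.
- by rewrite mulr0 normr0.
rewrite exprD -mulrA !normrM !normrX ler_wpM2l ?exprn_ge0 //.
apply: ler_pM; rewrite ?exprn_ge0 //; first by rewrite lerXn2r // nnegrE ?divr_ge0.
by apply: leB; rewrite (le_trans w_le) // ler_pdivrMr // ler_peMr // ler1n.
Qed.

Lemma sum_isolate_value (C : numFieldType) (c B K : C) (w : nat -> C)
    (Q : {poly C}) (m q N : nat) :
  c != 0 -> (forall x, `|x| <= `|c| -> `|Q.[x]| <= B) ->
  (forall j, [\/ w j = c, Q.[w j] = 0 | `|w j| <= `|c| / 2]) ->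
  \sum_(0 <= j < N) `|w j| ^+ m <= K ->
  `|\sum_(0 <= j < N) w j ^+ (m + q) * Q.[w j] -
    (\sum_(0 <= j < N) (w j == c))%:R * (c ^+ (m + q) * Q.[c])|
    <= K * ((`|c| / 2) ^+ q * B).
Proof.
move=> c_neq0 leB w_cases le_K.
have B_ge0 : 0 <= B by apply: le_trans (leB c (lexx _)).
rewrite natr_sum mulr_suml -sumrB; apply: le_trans (ler_norm_sum _ _ _) _.
apply: le_trans (_ : (\sum_(0 <= j < N) `|w j| ^+ m) * ((`|c| / 2) ^+ q * B) <= _).
  by rewrite mulr_suml; apply: ler_sum => j _; apply: isolate_value.
by rewrite ler_wpM2r // mulr_ge0 ?exprn_ge0 ?divr_ge0.
Qed.

(** The archimedean property, transferred from R to the partially ordered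
    field R[i]. *)
Lemma bounded_mul_pow2 (R : realType) (x L : R[i]) :
  0 <= x -> (forall q, x * 2 ^+ q <= L) -> x = 0.
Proof.
move=> x_ge0 le_L.
have L_ge0 : 0 <= L by apply: le_trans (le_L 0%N); rewrite mulr1.
have xE : (complex.Re x)%:C%C = x by rewrite RRe_real ?ger0_real.
have LE : (complex.Re L)%:C%C = L by rewrite RRe_real ?ger0_real.
move: x_ge0 le_L; rewrite -xE -LE ler0c le_eqVlt => /predU1P[<- //|r_gt0] le_L.
move: (complex.Re x) (complex.Re L) r_gt0 le_L => r l r_gt0 le_L.
have := le_L (Num.truncn (l / r)).+1.
rewrite -(rmorphMn _ 2 1) -rmorphXn -rmorphM lecR leNgt => /negP[].
rewrite mulrC -ltr_pdivrMr //; apply: lt_trans (truncnS_gt _) _.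
by rewrite -natrX ltr_nat ltn_expl.
Qed.

Lemma card_fiber (T : eqType) (u : nat -> T) (c : T) (J : nat) :
  (forall j, (J <= j)%N -> u j != c) ->
  ([set j | u j = c] #= `I_(\sum_(0 <= j < J) (u j == c)))%card.
Proof.
move=> u_neq; pose s := [seq j <- index_iota 0 J | u j == c].
rewrite (_ : [set j | u j = c] = [set` [fset j in s]%fset]); last first.
  apply/seteqP; split=> j /=; rewrite !inE mem_filter mem_index_iota /=.
    move=> uj; rewrite uj eqxx /= ltnNge; apply/negP => /u_neq.
    by rewrite uj eqxx.
  by case/andP => /eqP.
apply/card_eq_fsetP; rewrite finmap.card_fseq undup_id ?filter_uniq ?iota_uniq //.
by rewrite size_filter -sum1_count big_mkcond /=; apply: eq_bigr => j _; case: eqP.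
Qed.

Lemma sum_fiber_stable (T : eqType) (u : nat -> T) (c : T) (J N : nat) :
  (forall j, (J <= j)%N -> u j != c) -> (J <= N)%N ->
  (\sum_(0 <= j < N) (u j == c) = \sum_(0 <= j < J) (u j == c))%N.
Proof.
move=> u_neq le_JN; rewrite (big_cat_nat (n := J)) //= [X in (_ + X)%N]big_nat_cond.
by rewrite [X in (_ + X)%N]big1 ?addn0 // => j /andP[/andP[/u_neq /negPf -> _] _].
Qed.

(** The power sums with exponents at least m determine the multiplicity of
    every non-zero value. The multiplicities of c are compared through the
    polynomials 'X^q Q, where Q vanishes at all large values other than c. *)
Lemma eq_multiplicity (R : realType) (u v : nat -> R[i]) (m : nat) (K c : R[i]) :
  (forall N, \sum_(0 <= j < N) `|u j| ^+ m <= K) ->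
  (forall N, \sum_(0 <= j < N) `|v j| ^+ m <= K) ->
  (forall q, (m <= q)%N ->
    series (fun j => (u j ^+ q - v j ^+ q : R[i]^o)) @ \oo --> (0 : R[i]^o)) ->
  c != 0 ->
  ([set j | u j = c] #= [set j | v j = c])%card.
Proof.
move=> u_sum v_sum cvg0 c_neq0.
have half_gt0 : 0 < `|c| / 2 by rewrite divr_gt0 ?normr_gt0.
have [J1 u_small] := partial_sums_small _ _ _ _ _ u_sum half_gt0.
have [J2 v_small] := partial_sums_small _ _ _ _ _ v_sum half_gt0.
pose J := maxn J1 J2.
have half_lt : `|c| / 2 < `|c|.
  by rewrite ltr_pdivrMr // ltr_pMr ?normr_gt0 // ltr1n.
have {}u_small j : (J <= j)%N -> `|u j| < `|c| / 2.
  by rewrite geq_max => /andP[le1 _]; apply: u_small.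
have {}v_small j : (J <= j)%N -> `|v j| < `|c| / 2.
  by rewrite geq_max => /andP[_ le2]; apply: v_small.
have u_neq j : (J <= j)%N -> u j != c.
  by move=> /u_small; apply: contraTneq => ->; rewrite lt_gtF.
have v_neq j : (J <= j)%N -> v j != c.
  by move=> /v_small; apply: contraTneq => ->; rewrite lt_gtF.
(* The finite list s contains every value other than c that exceeds |c|/2 in
   modulus, since such values occur at indices below J. *)
pose s := [seq x <- map u (iota 0 J) ++ map v (iota 0 J) | x != c].
pose Q : {poly R[i]} := \prod_(x <- s) ('X - x%:P).
have Qc_neq0 : Q.[c] != 0.
  by rewrite -rootE root_prod_XsubC mem_filter eqxx.
have u_cases j : [\/ u j = c, Q.[u j] = 0 | `|u j| <= `|c| / 2].
  have [/u_small/ltW|lt_jJ] := leqP J j; first by constructor 3.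
  have [->|uj_neq] := eqVneq (u j) c; [by constructor 1 | constructor 2].
  apply/eqP; rewrite -rootE root_prod_XsubC mem_filter uj_neq mem_cat.
  by rewrite map_f // mem_iota.
have v_cases j : [\/ v j = c, Q.[v j] = 0 | `|v j| <= `|c| / 2].
  have [/v_small/ltW|lt_jJ] := leqP J j; first by constructor 3.
  have [->|vj_neq] := eqVneq (v j) c; [by constructor 1 | constructor 2].
  apply/eqP; rewrite -rootE root_prod_XsubC mem_filter vj_neq mem_cat.
  by rewrite [X in _ || X]map_f ?orbT // mem_iota.
have [B leB] := poly_disk_bound Q `|c|.
suff eq_count :
    (\sum_(0 <= j < J) (u j == c) = \sum_(0 <= j < J) (v j == c))%N.
  rewrite (card_eql (card_fiber _ _ _ _ u_neq)) eq_count card_eq_sym.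
  exact: card_fiber.
set a := (LHS); set b := (RHS).
suff /eqP : `|(a%:R - b%:R) * (c ^+ m * Q.[c])| = 0.
  rewrite normr_eq0 !mulf_eq0 expf_eq0 (negPf c_neq0) (negPf Qc_neq0) andbF.
  by rewrite !orbF subr_eq0 eqr_nat => /eqP.
(* K * B bounds the error made on u and on v; the summand 1 pays for stopping
   the series at an N where its partial sum is below (|c| / 2) ^+ q. *)
apply: (bounded_mul_pow2 _ _ (K * B + K * B + 1)) => // q.
have q_gt0 : 0 < (`|c| / 2) ^+ q by apply: exprn_gt0.
have /cvgrPdist_lt /(_ _ q_gt0) [N0 _ N0P] :=
  series_horner_cvg0 _ _ _ _ cvg0 Q (m + q)%N (leq_addr _ _).
pose N := maxn N0 J.
have := N0P N (leq_maxl _ _); rewrite /= sub0r normrN /series /= sumrB => S_lt.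
have := sum_isolate_value _ _ _ _ _ _ _ q N c_neq0 leB u_cases (u_sum N).
have := sum_isolate_value _ _ _ _ _ _ _ q N c_neq0 leB v_cases (v_sum N).
rewrite !(sum_fiber_stable _ _ c J N) ?leq_maxr // -/a -/b.
move: S_lt; set Su := \sum_(_ <= _ < _) _; set Sv := \sum_(_ <= _ < _) _.
set D := c ^+ (m + q) * Q.[c] => S_lt v_le u_le.
rewrite -(ler_pM2r q_gt0).
rewrite (_ : _ * _ * _ = `|(a%:R - b%:R) * D|); last first.
  rewrite /D exprD !normrM !normrX expr_div_n.
  by field.
rewrite (_ : (_ - _) * D = (Su - Sv) - (Su - a%:R * D) + (Sv - b%:R * D)); last by ring.
apply: le_trans (ler_normD _ _) _; apply: le_trans (lerD (ler_normB _ _) v_le) _.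
apply: le_trans (lerD (lerD (ltW S_lt) u_le) (lexx _)) _.
by rewrite le_eqVlt; apply/orP; left; apply/eqP; ring.
Qed.

(** * Enumerating the non-zero terms *)

Lemma seq_domain_bij (A : set nat) :
  exists (I : set nat) (f : nat -> nat), seq_domain I /\ set_bij I A f.
Proof.
have [/finite_setP[N A_N]|A_inf] := pselect (finite_set A).
  have /card_set_bijP[f f_bij] : (`I_N #= A)%card by rewrite card_eq_sym.
  by exists `I_N, f; split=> //; right; exists N.
have /card_set_bijP[f f_bij] : ([set: nat] #= A)%card.
  by rewrite card_eq_sym; apply: eq_card_nat.
by exists setT, f; split=> //; left.
Qed.

Lemma card_fiber_reindex (T : Type) (I A : set nat) (f : nat -> nat)
    (w : nat -> T) (c : T) :
  set_bij I A f ->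
  ([set i | I i /\ w (f i) = c] #= [set j | A j /\ w j = c])%card.
Proof.
move=> [f_fun f_inj f_surj]; apply/card_set_bijP; exists f; split.
- by move=> i [Ii wi]; split; [exact: f_fun | exact: wi].
- move=> i j; move=> /set_mem[Ii _] /set_mem[Ij _]; apply: f_inj; exact: mem_set.
- by move=> j [/f_surj[i Ii <-] wj]; exists i.
Qed.

(** Both cases of n %| q make the q-th power sums of xi and of its rotation
    agree: their difference is (1 - omega^(kq)) times the q-th moment, where
    either the first factor or the second is 0. *)
Lemma moments_multiplicity (R : realType) (n : nat) (xi : nat -> R[i]) (p : R)
    (k : nat) (c : R[i]) :
  (0 < n)%N -> 1 <= p -> in_lp p xi ->
  (forall q, (1 <= q)%N -> ~~ (n %| q)%N -> moment_is xi q 0) ->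
  c != 0 ->
  ([set j | xi j = c] #= [set j | xi j * omega R n ^+ k = c])%card.
Proof.
move=> n_gt0 p_ge1 xi_lp moment0 c_neq0.
have [m m_gt0 [K leK]] := in_lp_expn_partial_sums _ _ _ p_ge1 xi_lp.
apply: (eq_multiplicity _ _ _ m K) => // [N|q le_mq].
  under eq_bigr do rewrite normrM normrX norm_omega // expr1n mulr1.
  exact: leK.
set w := omega R n ^+ k.
rewrite (_ : series _ =
    ((1 - w ^+ q) \*: series (fun j => xi j ^+ q : R[i]^o) : nat -> R[i]^o)).
  have [n_dvd_q|n_ndvd_q] := boolP (n %| q)%N.
    rewrite (_ : w ^+ q = 1); last first.
      case/dvdnP: n_dvd_q => d ->.
      by rewrite /w -exprM mulnA mulnC exprM omega_expn // expr1n.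
    rewrite subrr (_ : _ \*: _ = fun=> 0); first exact: cvg_cst.
    by apply/funext => N /=; rewrite scale0r.
  rewrite -(scaler0 _ (1 - w ^+ q)); apply: cvgZl_tmp.
  by apply: moment0 => //; apply: leq_trans le_mq.
apply/funext => N; rewrite /= /series /= scaler_sumr.
by apply: eq_bigr => j _; rewrite exprMn /GRing.scale /=; ring.
Qed.

(** * Symmetry of the non-zero terms *)

Theorem theorem3p4 (R : realType) (n : nat) (xi : nat -> R[i]) (p : R)
    (hn : (2 <= n)%N)
    (hxi : exists j, xi j <> 0)
    (hp : 1 <= p)
    (hlp : in_lp p xi)
    (hM : forall q : nat, (1 <= q)%N -> ~~ (n %| q)%N -> moment_is xi q 0) :
  exists (I : set nat) (z : nat -> R[i]),
    [/\ seq_domain I,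
        symmetrical n I z
      & rearrangement [set j | xi j <> 0] xi I z].
Proof.
have n_gt0 : (0 < n)%N by apply: ltnW.
have [I [f [domI f_bij]]] := seq_domain_bij [set j | xi j <> 0].
exists I, (xi \o f); split=> //; last by exists f.
move=> k _ c.
rewrite (card_eql (card_fiber_reindex _ _ _ _ xi c f_bij)) card_eq_sym.
rewrite (card_eql (card_fiber_reindex _ _ _ _
  (fun j => xi j * omega R n ^+ k) c f_bij)).
have w_neq0 : omega R n ^+ k != 0.
  by rewrite expf_neq0 // -normr_gt0 norm_omega.
(* The enumerated terms are non-zero: the value 0 occurs in neither sequence,
   although it may occur in xi. *)
have [->|c_neq0] := eqVneq c 0.
  rewrite (_ : [set j | _ /\ _ * _ = 0] = set0); last first.
    apply/seteqP; split=> j // -[/eqP xij /eqP].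
    by rewrite mulf_eq0 (negPf xij) (negPf w_neq0).
  rewrite (_ : [set j | _ /\ xi j = 0] = set0) //.
  by apply/seteqP; split=> j // -[].
have fiber_neq0 g : (forall j, xi j = 0 -> g j != c) ->
    [set j | [set j | xi j <> 0] j /\ g j = c] = [set j | g j = c].
  move=> g0; apply/seteqP; split=> j /= [] //.
  by move=> gj; split=> // /g0/eqP.
rewrite !fiber_neq0 => [|j ->|j ->]; rewrite ?mul0r 1?eq_sym //.
by rewrite card_eq_sym; apply: moments_multiplicity hp hlp hM _.
Qed.
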